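(* Let $M$ be a tractable metric space and let $K \subseteq M$ be a non-empty compact subset. The following statements are equivalent. (i) The map $\mathsf{mag}\colon \mathrm{Cmp}_+(M) \to \mathbb{R}$ is continuous at $K$ (with respect to the Hausdorff metric on $\mathrm{Cmp}_+(M)$). (ii) $\displaystyle \lim_{r \searrow 0} \mathsf{mag}\big(\overline{\mathrm{th}}_M(K, r)\big) = \mathsf{mag}(K)$. (iii) For every $\epsilon > 0$ there exists $\delta > 0$ such that $\mathsf{mag}\big(\overline{\mathrm{th}}_M(K, \delta)\big) < \mathsf{mag}(K) + \epsilon$.
   Context: For a finite metric space $F$ with metric $d$ and $m$ points, its similarity matrix is $Z_F := (e^{-d(p,q)})_{p,q \in F} \in \mathbb{R}^{m \times m}$. A metric space $M$ is positive definite when every finite subspace has a positive definite similarity matrix. For a finite positive definite metric space $F$ the (unique) weighting is the vector $w$ with $Z_F w = 1_m$ (the all-ones vector), and the magnitude $\mathsf{mag}(F)$ is the sum of the components of $w$. For a compact positive definite metric space $K$, $\mathsf{mag}(K) := \sup\{\mathsf{mag}(F) : F \subseteq K \text{ finite}\}$ (possibly $\infty$ in general); this agrees with the previous definition for finite spaces. A metric space $M$ is tractable when it is positive definite and every closed ball in it is compact and has finite magnitude. $\mathrm{Cmp}_+(M)$ denotes the set of non-empty compact subspaces of $M$, equipped with the Hausdorff metric; for tractable $M$, $\mathsf{mag}$ is real-valued on all of $\mathrm{Cmp}_+(M)$. For $S \subseteq M$ and $r \geq 0$, the closed $r$-thickening is $\overline{\mathrm{th}}_M(S, r) := \{x \in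 M : d(S,x) \leq r\}$, where $d(S,x) = \inf_{y\in S} d(y,x)$. In a tractable space, closed thickenings of compact sets are compact and have finite magnitude. *)

(* Defs.v *)
From HB Require Import structures.
From mathcomp Require Import all_boot all_order all_algebra.
From mathcomp Require Import finmap.
From mathcomp Require Import all_classical all_reals all_analysis.

Set Implicit Arguments.
Unset Strict Implicit.
Unset Printing Implicit Defensive.

Import Order.TTheory GRing.Theory Num.Theory.
Import numFieldNormedType.Exports.

Local Open Scope classical_set_scope.
Local Open Scope ring_scope.

Definition posdefmx (R : realType) (m : nat) (A : 'M[R]_m) : Prop :=
  A^T = A /\ forall v : 'cV[R]_m, v != 0 -> 0 < (v^T *m A *m v) 0 0.

Section Magnitude.
Context {R : realType} {M : metricType R}.
Implicit Types (F : {fset M}) (S K : set M) (x y : M) (r : R).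

(* Rows and columns are the points of F, in the order given by [enum_val]. *)
Definition similarity_mx F : 'M[R]_#|{: F}| :=
  \matrix_(i, j) expR (- mdist (val (enum_val i)) (val (enum_val j))).

(* Meaningful when the equation has exactly one solution, as it has when the
   similarity matrix is positive definite; 0 when there is none. *)
Definition weighting F : 'cV[R]_#|{: F}| :=
  xget 0 [set w | similarity_mx F *m w = const_mx 1].

Definition fin_mag F : R := \sum_i weighting F i 0.

(* The empty F contributes 0, which does not change the supremum for nonempty
   S, since the magnitude of a point is 1. *)
Definition emag S : \bar R :=
  ereal_sup [set (fin_mag F)%:E | F in [set F : {fset M} | [set` F] `<=` S]].

(* Real-valued magnitude, for S of finite magnitude; see [emag_fin_num]. *)
Definition mag S : R := fine (emag S).

(* Not the library's [closed_ball], which is the closure of the open ball. *)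
Definition cball x r : set M := [set y | mdist x y <= r].

Definition set_dist S x : \bar R := ereal_inf [set (mdist y x)%:E | y in S].

Definition cthickening S r : set M := [set x | (set_dist S x <= r%:E)%E].

End Magnitude.

Definition posdef_space (R : realType) (M : metricType R) : Prop :=
  forall F : {fset M}, posdefmx (similarity_mx F).

Definition tractable (R : realType) (M : metricType R) : Prop :=
  posdef_space M /\
  forall (x : M) (r : R), 0 <= r ->
    compact (cball x r) /\ emag (cball x r) \is a fin_num.

Record necompact (R : realType) (M : metricType R) := NeCompact {
  nec_set :> set M ;
  nec_neq0 : nec_set !=set0 ;
  nec_compact : compact nec_set }.

Section Thickening.
Context {R : realType} {M : metricType R}.
Implicit Types (S K L N : set M) (x y : M) (r s e : R).

Lemma cthickeningP S r x :
  cthickening S r x <-> forall e, 0 < e -> exists2 y, S y & mdist y x < r + e.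
Proof.
split=> [Sx e e0|H].
  have /ereal_inf_lt[_ [y Sy <-]] : (set_dist S x < (r + e)%:E)%E.
    by apply: (le_lt_trans Sx); rewrite lte_fin ltrDl.
  by rewrite lte_fin => yx; exists y.
apply/lee_addgt0Pr => e e0; have [y Sy yx] := H e e0.
apply: ge_ereal_inf; exists (mdist y x)%:E; first by exists y.
by rewrite -EFinD lee_fin ltW.
Qed.

Lemma cthickening0 S : S `<=` cthickening S 0.
Proof.
move=> x Sx; apply/cthickeningP => e e0; exists x => //.
by rewrite mdistxx add0r.
Qed.

Lemma cthickening_le S r s : r <= s -> cthickening S r `<=` cthickening S s.
Proof. by move=> rs x /le_trans; apply; rewrite lee_fin. Qed.

Lemma cthickening_trans K L N r s :
  K `<=` cthickening L r -> L `<=` cthickening N s ->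
  K `<=` cthickening N (r + s).
Proof.
move=> KL LN x /KL/cthickeningP xL; apply/cthickeningP => e e0.
have e20 : 0 < e / 2 by rewrite divr_gt0.
have [y /LN/cthickeningP yN yx] := xL _ e20; have [z Nz zy] := yN _ e20.
exists z => //; apply: le_lt_trans (metric_triangle z y x) _.
by rewrite [e in ltRHS]splitr addrACA [ltLHS]addrC ltrD.
Qed.

Lemma compact_cthickening0 K : compact K -> cthickening K 0 `<=` K.
Proof.
move=> cK x /cthickeningP Kx.
have /closure_id -> := compact_closed (@metric_hausdorff _ M) cK.
move=> B /nbhs_ballP[e /= e0 xB]; have [y Ky yx] := Kx e e0.
by exists y; split => //; apply: xB; rewrite ballEmdist/= metric_sym -[e]add0r.
Qed.

Lemma compact_cball K x : compact K -> exists2 r, 0 <= r & K `<=` cball x r.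
Proof.
move=> /compact_near_coveringP/(_ R +oo (fun r y => mdist x y <= r) _) H.
have [y Ky|r [_ Kr]] := H; last first.
  exists (Num.max 0 (r + 1)); first by rewrite le_max lexx.
  by apply: Kr; rewrite lt_max ltrDl ltr01 orbT.
near=> z r => /=; apply: le_trans (metric_triangle x y z) _.
apply: (@le_trans _ _ (mdist x y + 1)).
  rewrite lerD2l ltW//.
  suff : ball y 1 z by rewrite ballEmdist.
  by near: z; exact: nbhsx_ballx.
by near: r; exact: nbhs_pinfty_ge (num_real _).
Unshelve. all: by end_near. Qed.

Lemma emag_le K L : K `<=` L -> (emag K <= emag L)%E.
Proof.
move=> KL; apply: ereal_sup_le => _ [F FK <-].
by exists F => //; exact: subset_trans KL.
Qed.

Lemma emag_ge0 K : (0 <= emag K)%E.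
Proof.
apply: ereal_sup_ubound; exists fset0 => /=.
  by move=> x /=; rewrite in_fset0.
rewrite /fin_mag big1// => i _.
by have := valP (enum_val i); rewrite in_fset0.
Qed.

Lemma emag_fin_num K x r : tractable M -> K `<=` cball x r ->
  emag K \is a fin_num.
Proof.
move=> [_ /(_ x (Num.max 0 r))]; rewrite le_max lexx => /(_ isT)[_ +] Kr.
rewrite !ge0_fin_numE ?emag_ge0//; apply: le_lt_trans; apply: emag_le => y /Kr.
by rewrite /cball/= le_max => ->; rewrite orbT.
Qed.

End Thickening.

Section HausdorffMetric.
Context {R : realType} {M : metricType R}.
Implicit Types K L N : necompact M.

Lemma nec_inj K L : nec_set K = nec_set L -> K = L.
Proof.
case: K L => [K K0 cK] [L L0 cL]/= KL; case: _ / KL in L0 cL *.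
by congr NeCompact; exact: Prop_irrelevance.
Qed.

HB.instance Definition _ := gen_eqMixin (necompact M).
HB.instance Definition _ := gen_choiceMixin (necompact M).

Definition hausdorff_radii K L : set R :=
  [set r | [/\ 0 <= r, K `<=` cthickening L r & L `<=` cthickening K r]].

Definition hausdorff_dist K L : R := inf (hausdorff_radii K L).

Lemma hausdorff_radii_lb K L : has_lbound (hausdorff_radii K L).
Proof. by exists 0 => r []. Qed.

Lemma hausdorff_radii_neq0 K L : hausdorff_radii K L !=set0.
Proof.
have [[x Kx] [y Ly]] := (nec_neq0 K, nec_neq0 L).
have [r r0 Lr] := compact_cball x (@nec_compact _ _ L).
have [s s0 Ks] := compact_cball y (@nec_compact _ _ K).
exists (r + s); split; first exact: addr_ge0.
- move=> z /Ks zs; apply/cthickeningP => e e0; exists y => //.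
  by rewrite (le_lt_trans zs)// -addrA addrCA ltrDl ltr_wpDl.
- move=> z /Lr zr; apply/cthickeningP => e e0; exists x => //.
  by rewrite (le_lt_trans zr)// -addrA ltrDl ltr_wpDl.
Qed.

Lemma hausdorff_dist_lt K L r :
  hausdorff_dist K L < r -> hausdorff_radii K L r.
Proof.
move=> /(inf_lt (hausdorff_radii_neq0 K L))[s [s0 KL LK] /ltW sr].
split; first exact: le_trans sr.
- exact: subset_trans (cthickening_le sr).
- exact: subset_trans (cthickening_le sr).
Qed.

Lemma hausdorff_dist_le K L r :
  hausdorff_radii K L r -> hausdorff_dist K L <= r.
Proof. by move=> ?; apply: ge_inf => //; exact: hausdorff_radii_lb. Qed.

Lemma hausdorff_dist_ge0 K L : 0 <= hausdorff_dist K L.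
Proof. by apply: lb_le_inf; [exact: hausdorff_radii_neq0|move=> r []]. Qed.

Let hausdorff_distxx K : hausdorff_dist K K = 0.
Proof.
apply/eqP; rewrite eq_le hausdorff_dist_ge0 andbT hausdorff_dist_le//.
by split => //; exact: cthickening0.
Qed.

Let hausdorff_dist_positivity K L : hausdorff_dist K L = 0 -> K = L.
Proof.
move=> KL0.
have KL e : 0 < e -> hausdorff_radii K L e.
  by move=> e0; apply: hausdorff_dist_lt; rewrite KL0.
apply/nec_inj/seteqP; split => x Kx; apply: compact_cthickening0;
  do ?[exact: nec_compact]; apply/lee_addgt0Pr => e /KL[_ H1 H2];
  rewrite add0e; [exact: H1|exact: H2].
Qed.

Let hausdorff_dist_sym K L : hausdorff_dist K L = hausdorff_dist L K.
Proof.
by rewrite /hausdorff_dist; congr inf; apply/seteqP; split => r [].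
Qed.

Let hausdorff_dist_triangle L K N :
  hausdorff_dist K N <= hausdorff_dist K L + hausdorff_dist L N.
Proof.
apply/ler_addgt0Pr => e e0; have e20 : 0 < e / 2 by rewrite divr_gt0.
have := @hausdorff_dist_lt K L (hausdorff_dist K L + e / 2).
have := @hausdorff_dist_lt L N (hausdorff_dist L N + e / 2).
rewrite !ltrDl => /(_ e20)[s0 LN NL] /(_ e20)[r0 KL LK].
rewrite [e]splitr addrACA; apply: hausdorff_dist_le; split.
- exact: addr_ge0.
- exact: cthickening_trans KL LN.
- by rewrite addrC; exact: cthickening_trans NL LK.
Qed.

HB.instance Definition _ := isMetric.Build R (necompact M)
  hausdorff_distxx hausdorff_dist_positivity hausdorff_dist_sym
  hausdorff_dist_triangle.

Lemma mdist_necompactE K L : mdist K L = hausdorff_dist K L.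
Proof. by []. Qed.

End HausdorffMetric.

(* Main.v *)
Require Import Defs.
From mathcomp Require Import all_boot all_order all_algebra.
From mathcomp Require Import finmap ring lra.
From mathcomp Require Import all_classical all_reals all_analysis.

Import Order.TTheory GRing.Theory Num.Theory.
Import numFieldNormedType.Exports.

Local Open Scope classical_set_scope.
Local Open Scope ring_scope.

(** Magnitude is monotone, so an upper bound on [mag] near [K] only concerns the
    thickenings of [K]: any [L] at Hausdorff distance less than [delta] from [K]
    lies in [cthickening K delta], whence [mag L <= mag (cthickening K delta)].
    Condition (iii) is therefore upper semicontinuity of [mag] at [K].
    Conversely the thickenings are themselves points of the hyperspace that
    converge to [K], so continuity at [K] gives (ii), and (ii) gives (iii).

    What remains is lower semicontinuity, which holds at every [K]. It comes
    from a variational description of finite magnitude: for a positive definite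
    similarity matrix [Z], the expression [2 * sum u - u^T Z u] is maximal when
    [u] is the weighting, and the maximum is the magnitude
    ([quad_le_sum_solution]). The inequality persists when [u] is a family of
    weights on points [p i] of a finite space, with repetitions allowed
    ([family_form_le]), and for fixed [u] the expression depends continuously on
    the distances between the points ([family_form_near]). So let a finite
    [F] inside [K] nearly attain [mag K]. If [K] is close to [L], move each point
    of [F] to a nearby point of [L], keeping the weights: the expression
    changes little, and it is a lower bound for [mag L]
    ([emag_lower_semicontinuous]). Working with this expression avoids
    inverting matrices that vary, and the points of [F] may collide when they
    are moved. *)

(** * The variational inequality for positive definite matrices *)

Lemma posdefmx_unit (R : realType) (m : nat) (A : 'M[R]_m) :
  posdefmx A -> A \in unitmx.
Proof.
move=> [_ A_gt0]; rewrite unitmxE unitfE; apply/det0P => -[v v0 vA].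
have := A_gt0 v^T; rewrite trmx_eq0 => /(_ v0).
by rewrite trmxK vA mul0mx mxE ltxx.
Qed.

(** This is [0 <= (w - g)^T A (w - g)], expanded with [A w = 1]. *)
Lemma quad_le_sum_solution (R : realType) (m : nat) (A : 'M[R]_m)
    (w g : 'cV[R]_m) : posdefmx A -> A *m w = const_mx 1 ->
  (\sum_i g i 0) *+ 2 - (g^T *m A *m g) 0 0 <= \sum_i w i 0.
Proof.
move=> [At A_gt0] Aw.
have sumE (v : 'cV[R]_m) : (v^T *m (const_mx 1 : 'cV_m)) 0 0 = \sum_i v i 0.
  by rewrite mxE; apply: eq_bigr => i _; rewrite !mxE mulr1.
have wAg : (w^T *m A *m g) 0 0 = \sum_i g i 0.
  rewrite -[X in _ *m X *m _]At -trmx_mul Aw mxE.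
  by apply: eq_bigr => i _; rewrite !mxE mul1r.
have : 0 <= ((w - g)^T *m A *m (w - g)) 0 0.
  have [->|/A_gt0/ltW//] := eqVneq (w - g) 0.
  by rewrite mulmx0 mxE.
have entryB (B C : 'M[R]_1) : (B - C) 0 0 = B 0 0 - C 0 0 by rewrite !mxE.
rewrite [(w - g)^T]linearB/= !mulmxBl !mulmxBr !entryB wAg -!(mulmxA _ A w) Aw !sumE.
lra.
Qed.

(** [t |-> exp (- t)] is 1-Lipschitz on the nonnegative reals; the one-sided form
    bounds each entry of a similarity matrix when points are moved. *)
Lemma expRN_dist_le (R : realType) (a b c : R) :
  0 <= b -> a <= b + c -> 0 <= c -> expR (- b) <= expR (- a) + c.
Proof.
move=> b0 ab c0.
have [|ba] := leP a b; first by move=> ?; rewrite ler_wpDr// ler_expR lerN2.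
have b1 : expR (- b) <= 1 by rewrite -expR0 ler_expR oppr_le0.
have -> : - a = - b + (b - a) by lra.
have X1 := expR_ge1Dx (b - a); have E0 := expR_gt0 (- b).
rewrite expRD; set E := expR (- b) in b1 E0 *; set X := expR _ in X1 *.
have : 0 <= E * (X - (1 + (b - a))) by rewrite mulr_ge0 ?subr_ge0// ltW.
have : 0 <= (1 - E) * (a - b) by rewrite mulr_ge0 ?subr_ge0// ltW.
lra.
Qed.

(** * Lower semicontinuity of magnitude *)

Section Families.
Context {R : realType} {M : metricType R}.
Implicit Types (F : {fset M}) (S T : set M).

Lemma similarity_mx_weighting F : posdefmx (similarity_mx F) ->
  similarity_mx F *m weighting F = const_mx 1.
Proof.
move=> /posdefmx_unit ZF.
apply: (@xgetPex _ 0 [set w | similarity_mx F *m w = const_mx 1]).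
by exists (invmx (similarity_mx F) *m const_mx 1); rewrite /= mulKVmx.
Qed.

(** The variational expression, for weights on a family of points rather than on
    a finite set, so that distinct indices may carry the same point. *)
Definition family_form n (p : 'I_n -> M) (u : 'cV[R]_n) : R :=
  (\sum_i u i 0) *+ 2
  - \sum_i \sum_j u i 0 * u j 0 * expR (- mdist (p i) (p j)).

Lemma quad_similarity_mx F (u : 'cV[R]_#|{: F}|) :
  (u^T *m similarity_mx F *m u) 0 0 =
  \sum_i \sum_j u i 0 * u j 0
    * expR (- mdist (val (enum_val i)) (val (enum_val j))).
Proof.
rewrite mxE exchange_big/=; apply: eq_bigr => j _; rewrite mxE mulr_suml.
by apply: eq_bigr => i _; rewrite !mxE mulrAC.
Qed.

Lemma family_form_weighting F : posdefmx (similarity_mx F) ->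
  family_form _ (fun i => val (enum_val i)) (weighting F) = fin_mag F.
Proof.
move=> /similarity_mx_weighting Zw.
rewrite /family_form -quad_similarity_mx -mulmxA Zw mxE /fin_mag.
under [X in _ - X]eq_bigr do rewrite !mxE mulr1.
by rewrite mulr2n addrK.
Qed.

(** Adding up the weights of the indices that carry the same point turns the
    family into a vector indexed by [F], with the same total weight and the same
    quadratic form. *)
Lemma family_form_le F n (p : 'I_n -> M) (u : 'cV[R]_n) :
  posdefmx (similarity_mx F) -> (forall i, p i \in F) ->
  family_form _ p u <= fin_mag F.
Proof.
move=> ZF pF; pose f i := enum_rank [` pF i]%fset.
have pE i : p i = val (enum_val (f i)) by rewrite enum_rankK.
(* P is the incidence matrix of indices and points, so P^T u adds weights up. *)
pose P : 'M[R]_(n, _) := rowsub f 1%:M.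
apply: le_trans (quad_le_sum_solution _ _ _ _ (P^T *m u) ZF
  (similarity_mx_weighting _ ZF)).
suff -> : family_form _ p u = (\sum_i (P^T *m u) i 0) *+ 2
    - ((P^T *m u)^T *m similarity_mx F *m (P^T *m u)) 0 0 by [].
congr (_ *+ 2 - _).
  under [RHS]eq_bigr do rewrite mxE.
  rewrite exchange_big/=; apply: eq_bigr => i _.
  rewrite (bigD1 (f i))//= big1 ?addr0; first by rewrite !mxE eqxx mul1r.
  by move=> k kfi; rewrite !mxE eq_sym (negPf kfi) mul0r.
have PZP : P *m similarity_mx F *m P^T = mxsub f f (similarity_mx F).
  apply/matrixP => i j; rewrite /P mul_rowsub_mx mul1mx trmx_mxsub trmx1.
  rewrite mul_rowsub_mx !mxE (bigD1 (f j))//= big1 ?addr0.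
    by rewrite !mxE eqxx mulr1.
  by move=> k kfj; rewrite !mxE (negPf kfj) mulr0.
have -> : (P^T *m u)^T *m similarity_mx F *m (P^T *m u)
    = u^T *m (P *m similarity_mx F *m P^T) *m u.
  by rewrite trmx_mul trmxK !mulmxA.
rewrite PZP mxE exchange_big/=; apply: eq_bigr => j _.
rewrite mxE mulr_suml; apply: eq_bigr => i _.
by rewrite !mxE !pE mulrAC.
Qed.

Lemma family_form_near n (p q : 'I_n -> M) (u : 'cV[R]_n) (h : R) :
  0 <= h -> (forall i, mdist (p i) (q i) <= h) ->
  family_form _ p u - (\sum_i \sum_j `|u i 0 * u j 0|) * (h *+ 2)
    <= family_form _ q u.
Proof.
move=> h0 pq; rewrite /family_form -addrA lerD2l -opprD lerN2.
rewrite mulr_suml -big_split/=; apply: ler_sum => i _.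
rewrite mulr_suml -big_split/=; apply: ler_sum => j _.
have pqd (p' q' : 'I_n -> M) : (forall i, mdist (p' i) (q' i) <= h) ->
    expR (- mdist (p' i) (p' j)) <= expR (- mdist (q' i) (q' j)) + h *+ 2.
  move=> pq'; apply: expRN_dist_le; [exact: mdist_ge0| |by rewrite mulrn_wge0].
  have := metric_triangle (q' i) (p' i) (q' j).
  have := metric_triangle (p' i) (p' j) (q' j).
  have := pq' i; have := pq' j; rewrite [mdist (q' i) (p' i)]metric_sym; lra.
have dp_le := pqd _ _ pq.
have dq_le : expR (- mdist (q i) (q j)) <= expR (- mdist (p i) (p j)) + h *+ 2.
  by apply: pqd => k; rewrite metric_sym.
(* Which of the two bounds matters depends on the sign of the coefficient. *)
have [|] := leP 0 (u i 0 * u j 0) => [u0|/ltW u0].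
  by rewrite (ger0_norm u0) -mulrDr ler_wpM2l.
rewrite (ler0_norm u0) mulNr; nra.
Qed.

(** A finite subspace [F] of [S] with [fin_mag F > a] is moved point by point into
    [T], carrying its weighting along; the new family bounds [emag T] below. *)
Lemma emag_lower_semicontinuous S (a : R) : posdef_space M ->
  (a%:E < emag S)%E ->
  exists2 h : R, 0 < h &
    forall T, S `<=` cthickening T h -> (a%:E < emag T)%E.
Proof.
move=> hM /ereal_sup_gt[_ [F FS <-]]; rewrite lte_fin => aF.
set u := weighting F; set B := \sum_i \sum_j `|u i 0 * u j 0|.
have B0 : 0 <= B by apply: sumr_ge0 => i _; apply: sumr_ge0.
have d0 : 0 < fin_mag F - a by rewrite subr_gt0.
(* The points move by at most 2h, which costs at most B * 4h; the 1 in the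
   denominator allows for B = 0. *)
pose h := (fin_mag F - a) / ((B + 1) * 4).
have h0 : 0 < h by rewrite divr_gt0// mulr_gt0// ltr_wpDl.
exists h => // T ST.
have /choice[q qP] (i : 'I_#|{: F}|) :
    exists y, T y /\ mdist (val (enum_val i)) y <= h *+ 2.
  have /ST/cthickeningP/(_ h h0)[y Ty yi] : S (val (enum_val i)).
    by apply: FS; exact: (valP (enum_val i)).
  by exists y; rewrite metric_sym mulr2n ltW.
pose G := [fset q i | i : 'I_#|{: F}|]%fset.
have GT : [set` G] `<=` T.
  by move=> x /imfsetP[i _ ->]; have [] := qP i.
apply: (@lt_le_trans _ _ (fin_mag G)%:E); last first.
  by apply: ereal_sup_ubound; exists G.
have h20 : 0 <= h *+ 2 by rewrite mulrn_wge0// ltW.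
have qG i : q i \in G by exact: in_imfset.
have := family_form_near _ _ q u _ h20 (fun i => (qP i).2).
rewrite family_form_weighting// -/B => near_ge.
rewrite lte_fin; apply: lt_le_trans (family_form_le G _ q u (hM G) qG).
apply: lt_le_trans near_ge.
have -> : B * (h *+ 2 *+ 2) = (fin_mag F - a) * (B / (B + 1)).
  have B1 : B + 1 != 0 by rewrite gt_eqF// ltr_wpDl.
  by rewrite /h; field.
have : B / (B + 1) < 1 by rewrite ltr_pdivrMr ?mul1r ?ltrDl// ltr_wpDl.
nra.
Qed.

End Families.

(** * Thickenings in a tractable space *)

Section Thickenings.
Context {R : realType} {M : metricType R}.
Implicit Types (S : set M) (K L : necompact M).

Lemma closed_cthickening S (r : R) : closed (cthickening S r).
Proof.
move=> x xcl; apply/lee_addgt0Pr => e e0; rewrite -EFinD addrC.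
have /xcl[y [Sy]] : nbhs x (ball x e) by exact: nbhsx_ballx.
rewrite ballEmdist/= => xy.
apply: (@cthickening_trans _ _ [set x] (cthickening S r)) (erefl x) => // _ ->.
apply/cthickeningP => h h0; exists y => //.
by rewrite metric_sym (lt_trans xy)// ltrDl.
Qed.

Lemma cthickening_bounded K (r : R) : 0 <= r ->
  exists x s, 0 <= s /\ cthickening K r `<=` cball x s.
Proof.
move=> r0; have [x _] := nec_neq0 K.
have [s s0 Ks] := compact_cball x (@nec_compact _ _ K).
exists x, (s + (r + 1)); split; first by rewrite !addr_ge0.
move=> z /cthickeningP/(_ 1 ltr01)[y /Ks xy yz].
by apply: le_trans (metric_triangle x y z) _; rewrite lerD// ltW.
Qed.

Lemma compact_cthickening K (r : R) : tractable M -> 0 <= r ->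
  compact (cthickening K r).
Proof.
move=> [_ hM] r0; have [x [s [s0 Ks]]] := cthickening_bounded K r r0.
by apply: subclosed_compact Ks; [exact: closed_cthickening|have [] := hM x s s0].
Qed.

Lemma emag_nec_fin_num K : tractable M -> emag K \is a fin_num.
Proof.
move=> hM; have [x _] := nec_neq0 K.
have [s _ Ks] := compact_cball x (@nec_compact _ _ K).
exact: emag_fin_num hM Ks.
Qed.

Lemma emag_cthickening_fin_num K (r : R) : tractable M -> 0 <= r ->
  emag (cthickening K r) \is a fin_num.
Proof.
move=> hM r0; have [x [s [_ Ks]]] := cthickening_bounded K r r0.
exact: emag_fin_num hM Ks.
Qed.

Lemma mag_le_cthickening K L (r : R) : tractable M -> 0 <= r ->
  L `<=` cthickening K r -> mag L <= mag (cthickening K r).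
Proof.
move=> hM r0 LK; apply: fine_le; [exact: emag_nec_fin_num| |exact: emag_le].
exact: emag_cthickening_fin_num.
Qed.

(** Only the inclusion of [K] in a thickening of [L] matters here, and only the
    opposite one in [mag_le_cthickening]: each half of the Hausdorff distance
    controls one side of [mag L]. *)
Lemma mag_lower_semicontinuous K (e : R) : tractable M -> 0 < e ->
  exists2 h : R, 0 < h &
    forall L, K `<=` cthickening L h -> mag K - e < mag L.
Proof.
move=> hM e0.
have : ((mag K - e)%:E < emag K)%E.
  by rewrite -[ltRHS]fineK ?emag_nec_fin_num// lte_fin ltrBlDr ltrDl.
move=> /(emag_lower_semicontinuous _ _ hM.1)[h h0 H]; exists h => // L /H.
by rewrite -[in X in X -> _](fineK (emag_nec_fin_num L hM)) lte_fin.
Qed.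

End Thickenings.

(** * Continuity at a compact subspace *)

Theorem lemma3p2 (R : realType) (M : metricType R) (hM : tractable M)
    (K : necompact M) :
  let i := {for K, continuous (fun L : necompact M => mag L)} in
  let ii := mag (cthickening K r) @[r --> 0^'+] --> mag K in
  let iii := forall eps : R, 0 < eps ->
    exists2 delta : R, 0 < delta & mag (cthickening K delta) < mag K + eps in
  (i <-> ii) /\ (ii <-> iii).
Proof.
move=> i ii iii.
have i_ii : i -> ii.
  move=> /cvgrPdist_lt Ki; apply/cvgrPdist_lt => e e0.
  have /nbhs_ballP[d /= d0 Kd] := Ki e e0.
  near=> r.
  have r0 : 0 < r by [].
  have Sr (S : set M) : S `<=` cthickening S r.
    by move=> x Sx; apply: (cthickening_le (ltW r0)); exact: cthickening0.
  pose L := NeCompact (subset_nonempty (Sr K) (nec_neq0 K))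
    (compact_cthickening K r hM (ltW r0)).
  apply: (Kd L); rewrite ballEmdist/= mdist_necompactE.
  apply: le_lt_trans (_ : r < d); last by near: r; exact: nbhs_right_lt.
  apply: hausdorff_dist_le; split; [exact: ltW| |by []].
  exact: subset_trans (Sr K) (Sr L).
have ii_iii : ii -> iii.
  move=> Kii e e0.
  have Ke : mag K < mag K + e by rewrite ltrDl.
  near (0:R)^'+ => r; exists r => //.
  by near: r; exact: cvgr_lt Kii _ Ke.
have iii_i : iii -> i.
  move=> Kiii; apply/(@cvgrPdist_lt _ _ _ (nbhs K) (nbhs_filter K)) => e e0.
  have [d d0 Kd] := Kiii e e0.
  have [h h0 Kh] := mag_lower_semicontinuous K e hM e0.
  apply/nbhs_ballP; exists (Num.min d h); first by rewrite /= lt_min d0.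
  move=> L; rewrite ballEmdist/= mdist_necompactE lt_min => /andP[].
  move=> /hausdorff_dist_lt[_ _ LK] /hausdorff_dist_lt[_ KL _].
  have := Kh L KL; have := mag_le_cthickening K L d hM (ltW d0) LK.
  by rewrite ltr_norml; lra.
tauto.
Unshelve. all: by end_near. Qed.
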